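(* The axiom system $\mathsf{EKB}$ is sound for $\mathcal{L}_{E,K,B}$ with respect to the class of evidence models satisfying (E1) under doxastic-evidence semantics: every theorem of $\mathsf{EKB}$ is true at every doxastic evidence scenario of every evidence model satisfying (E1).
   Context: $\mathcal{L}_{E,K,B}$ is generated by $\phi ::= p \mid \neg\phi \mid \phi\wedge\psi \mid E\phi \mid K\phi \mid B\phi$, $p$ in a countable set $\textsc{prop}$. An evidence model is $(X,\mathcal{E},I,v)$ with $X$ nonempty, $\mathcal{E}$ a nonempty set, $I_e:X\to 2^X$ for each $e\in\mathcal{E}$, $v:\textsc{prop}\to 2^X$. Let $U_e=\{x : x\in I_e(x)\}$. Condition (E1): $y\in I_e(x)$ implies $y\in I_e(y)$. A doxastic evidence scenario is a triple $(x,e,V)$ with $x\in U_e$ and $\emptyset\neq V\subseteq U_e$. Doxastic-evidence semantics: $(x,e,V)\models p$ iff $x\in v(p)$; Booleans as usual; $(x,e,V)\models E\phi$ iff $I_e(x)\subseteq[\![\phi]\!]^{e,V}$; $(x,e,V)\models K\phi$ iff $U_e\subseteq[\![\phi]\!]^{e,V}$; $(x,e,V)\models B\phi$ iff $V\subseteq[\![\phi]\!]^{e,V}$, where $[\![\phi]\!]^{e,V}=\{y\in U_e : (y,e,V)\models\phi\}$. $\mathsf{EKB}$ consists of: classical propositional logic with modus ponens; $\mathsf{S5}$ for $K$ (axioms K, T, 4, 5 and necessitation); $\mathsf{KT}$ for $E$ (axioms K, T and necessitation); $K\phi\to E\phi$; $B(\phi\to\psi)\to(B\phi\to B\psi)$;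 $B\phi\to\neg B\neg\phi$; $B\phi\to KB\phi$; and $K\phi\to B\phi$. *)

(* Defs.v *)
From mathcomp Require Import all_boot.
From mathcomp Require Import boolp classical_sets.

Set Implicit Arguments.
Unset Strict Implicit.
Unset Printing Implicit Defensive.

Local Open Scope classical_set_scope.

Inductive form (P : Type) : Type :=
| Atom of P
| Neg of form P
| And of form P & form P
| Ebox of form P
| Kbox of form P
| Bbox of form P.

Definition Imp (P : Type) (phi psi : form P) : form P :=
  Neg (And phi (Neg psi)).

Record evidence_model (P : Type) := EvidenceModel {
  state : Type;
  evidence : Type;
  state_nonempty : [set: state] !=set0;
  evidence_nonempty : [set: evidence] !=set0;
  I : evidence -> state -> set state;
  v : P -> set state
}.

Section Semantics.
Context {P : Type} (M : evidence_model P).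

Definition U (e : evidence M) : set (state M) := [set x | I e x x].

Definition E1 : Prop :=
  forall (e : evidence M) (x y : state M), I e x y -> I e y y.

Definition doxastic_scenario
    (x : state M) (e : evidence M) (V : set (state M)) : Prop :=
  [/\ U e x, V !=set0 & V `<=` U e].

(* [sat e V phi x] is (x, e, V) |= phi. It is total in (x, e, V), but each
   modal clause only evaluates its argument at points of [U e], so that
   starting from a scenario only scenarios are ever evaluated. *)
Fixpoint sat (e : evidence M) (V : set (state M)) (phi : form P)
    (x : state M) {struct phi} : Prop :=
  match phi with
  | Atom p => v p x
  | Neg phi1 => ~ sat e V phi1 x
  | And phi1 phi2 => sat e V phi1 x /\ sat e V phi2 x
  | Ebox phi1 => I e x `<=` [set y | U e y /\ sat e V phi1 y]
  | Kbox phi1 => U e `<=` [set y | U e y /\ sat e V phi1 y]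
  | Bbox phi1 => V `<=` [set y | U e y /\ sat e V phi1 y]
  end.

End Semantics.

(* Classical valuations treat atoms and modal formulas as propositional
   letters, so [tautology] holds exactly of the substitution instances of
   propositional tautologies. *)
Fixpoint prop_eval (P : Type) (h : form P -> bool) (phi : form P) : bool :=
  match phi with
  | Neg phi1 => ~~ prop_eval h phi1
  | And phi1 phi2 => prop_eval h phi1 && prop_eval h phi2
  | _ => h phi
  end.

Definition tautology (P : Type) (phi : form P) : Prop :=
  forall h : form P -> bool, prop_eval h phi.

Inductive EKB (P : Type) : form P -> Prop :=
| EKB_taut phi : tautology phi -> EKB phi
| EKB_mp phi psi : EKB (Imp phi psi) -> EKB phi -> EKB psi
| EKB_K_K phi psi :
    EKB (Imp (Kbox (Imp phi psi)) (Imp (Kbox phi) (Kbox psi)))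
| EKB_K_T phi : EKB (Imp (Kbox phi) phi)
| EKB_K_4 phi : EKB (Imp (Kbox phi) (Kbox (Kbox phi)))
| EKB_K_5 phi : EKB (Imp (Neg (Kbox phi)) (Kbox (Neg (Kbox phi))))
| EKB_K_nec phi : EKB phi -> EKB (Kbox phi)
| EKB_E_K phi psi :
    EKB (Imp (Ebox (Imp phi psi)) (Imp (Ebox phi) (Ebox psi)))
| EKB_E_T phi : EKB (Imp (Ebox phi) phi)
| EKB_E_nec phi : EKB phi -> EKB (Ebox phi)
| EKB_KE phi : EKB (Imp (Kbox phi) (Ebox phi))
| EKB_B_K phi psi :
    EKB (Imp (Bbox (Imp phi psi)) (Imp (Bbox phi) (Bbox psi)))
| EKB_B_D phi : EKB (Imp (Bbox phi) (Neg (Bbox (Neg phi))))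
| EKB_BKB phi : EKB (Imp (Bbox phi) (Kbox (Bbox phi)))
| EKB_KB phi : EKB (Imp (Kbox phi) (Bbox phi)).

(* Main.v *)
Require Import Defs.
From mathcomp Require Import all_boot.
From mathcomp Require Import boolp classical_sets.

(** Induction on the derivation, with [e] and [V] fixed and truth claimed at all points of [U e].
    Propositional tautologies hold because truth at a point is a classical valuation
    ([prop_eval_sat]). [Kbox] and [Bbox] quantify over the fixed sets [U e] and [V], which makes the
    introspection axioms immediate; (E1) places each [I e x] inside [U e], linking [Ebox] to
    [Kbox]. *)

Lemma sat_Imp (P : Type) (M : evidence_model P) (e : evidence M)
    (V : set (state M)) (phi psi : form P) (x : state M) :
  sat e V (Imp phi psi) x <-> (sat e V phi x -> sat e V psi x).
Proof.
split=> [nHphi Hphi|Hphi [/Hphi]] //=.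
by apply: contrapT => nHpsi; apply: nHphi.
Qed.

(** Both sides treat the connectives pointwise and agree by definition on atoms and modal
    formulas. *)
Lemma prop_eval_sat (P : Type) (M : evidence_model P) (e : evidence M)
    (V : set (state M)) (x : state M) (phi : form P) :
  prop_eval (fun psi => `[< sat e V psi x >]) phi = `[< sat e V phi x >].
Proof.
elim: phi => //= [phi -> | phi -> psi ->].
- by rewrite asbool_neg.
- by rewrite asbool_and.
Qed.

Lemma sat_tautology (P : Type) (M : evidence_model P) (e : evidence M)
    (V : set (state M)) (x : state M) (phi : form P) :
  tautology phi -> sat e V phi x.
Proof.
move=> /(_ (fun psi => `[< sat e V psi x >])).
by rewrite prop_eval_sat => /asboolP.
Qed.

Theorem theorem3 (P : countType) (phi : form P) (Hphi : EKB phi)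
    (M : evidence_model P) (HM : E1 M)
    (x : state M) (e : evidence M) (V : set (state M))
    (Hs : doxastic_scenario x e V) :
  sat e V phi x.
Proof.
case: Hs => Ux [z Vz] VU.
(* The point is generalized because necessitation needs the premise throughout [U e]. *)
elim: Hphi x Ux => {phi}.
- by move=> phi taut x _; exact: sat_tautology.
- move=> phi psi _ IHimp _ IHphi x Ux.
  by have /sat_Imp := IHimp x Ux; apply; exact: IHphi.
- move=> phi psi x Ux; apply/sat_Imp => Kimp; apply/sat_Imp => Kphi y Uy.
  have [_ /sat_Imp imp] := Kimp y Uy.
  by split=> //; apply: imp; have [] := Kphi y Uy.
- by move=> phi x Ux; apply/sat_Imp => /(_ x Ux)[].
(* For 4 and 5: the truth of [Kbox phi] is the same at every point. *)
- by move=> phi x Ux; apply/sat_Imp => Kphi y Uy; split.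
- by move=> phi x Ux; apply/sat_Imp => nKphi y Uy; split.
- by move=> phi _ IH x Ux y Uy; split=> //; exact: IH.
- move=> phi psi x Ux; apply/sat_Imp => Eimp; apply/sat_Imp => Ephi y Iy.
  have [Uy /sat_Imp imp] := Eimp y Iy.
  by split=> //; apply: imp; have [] := Ephi y Iy.
(* [U e x] is by definition [I e x x], so [Ebox] is reflexive here. *)
- by move=> phi x Ux; apply/sat_Imp => /(_ x Ux)[].
- by move=> phi _ IH x Ux y /HM Uy; split=> //; exact: IH.
- by move=> phi x Ux; apply/sat_Imp => Kphi y /HM Uy; exact: Kphi.
- move=> phi psi x Ux; apply/sat_Imp => Bimp; apply/sat_Imp => Bphi y Vy.
  have [Uy /sat_Imp imp] := Bimp y Vy.
  by split=> //; apply: imp; have [] := Bphi y Vy.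
(* Nonemptiness of [V] gives consistency: [phi] and its negation would both hold at [z]. *)
- move=> phi x Ux; apply/sat_Imp => Bphi Bnphi.
  by have [_] := Bnphi z Vz; apply; have [] := Bphi z Vz.
- by move=> phi x Ux; apply/sat_Imp => Bphi y Uy; split.
- by move=> phi x Ux; apply/sat_Imp => Kphi y /VU Uy; exact: Kphi.
Qed.
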